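(* Let $n\ge2$ and let $\Omega\subset\mathbb{R}^n$ be a domain satisfying the separation property (with distinguished point $x_0$ and constant $C_s\ge1$). Then $\Omega$ is a John domain if and only if there exists a positive constant $C_E$ such that for every separating ball $B$, $$|E_B|\le C_E|B|,$$ where $E_B$ is the $B$-end.
   Context: A domain is a connected, open, proper subset of $\mathbb{R}^n$, $n\ge2$. For $x\in\Omega$ put $\rho(x)=\mathrm{dist}(x,\partial\Omega)$; $B(x,r)$ denotes the ball with center $x$ and radius $r$; $|A|$ is the Lebesgue measure of $A$. Separation property: a domain $\Omega\subset\mathbb{R}^n$ with a distinguished point $x_0\in\Omega$ has the separation property if there is a constant $C_s\ge1$ such that for each $x\in\Omega$ there is a curve $\gamma:[0,1]\to\Omega$ with $\gamma(0)=x$, $\gamma(1)=x_0$, and such that for each $t\in[0,1]$, with $B:=B(\gamma(t),C_s\rho(\gamma(t)))$, either $\gamma([0,t])\subset B$ or each $y\in\gamma([0,t])\setminus B$ belongs to a different component of $\Omega\setminus\partial B$ than $x_0$ (that is, no component of $\Omega\setminus\partial B$ contains both $y$ and $x_0$). In the latter case (i.e. for such a curve $\gamma$ and $t$ with $\gamma([0,t])\not\subset B$), $B$ is called a separating ball, and the union of the components of $\Omega\setminus B$ not containing $x_0$ is called the $B$-end and denoted $E_B$. John domain: a bounded domain $\Omega\subset\mathbb{R}^n$ is a John domain if there are a distinguished point in $\Omega$, say $x_1$, and a constant $C_J>0$ such that for every $x\in\Omega$ there is a curve $\gamma:[0,l(\gamma)]\to\Omega$, parametrised by arclength, with $\gamma(0)=x$,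 $\gamma(l(\gamma))=x_1$ and $\rho(\gamma(t))\ge C_Jt$ for all $t$. *)

(* Defs.v *)
From HB Require Import structures.
From mathcomp Require Import all_boot all_order all_algebra.
From mathcomp Require Import all_classical all_reals all_analysis.

Set Implicit Arguments.
Unset Strict Implicit.
Unset Printing Implicit Defensive.

Import Order.TTheory GRing.Theory Num.Theory.
Import numFieldNormedType.Exports.

Local Open Scope classical_set_scope.
Local Open Scope ring_scope.

Section SeparationJohn.
Context {R : realType} {n : nat}.
Notation Rn := 'rV[R]_n.
Implicit Types (A B C Omega : set Rn) (x y : Rn) (g : R -> Rn).

(* R^n is 'rV[R]_n.  The library norm on 'rV[R]_n is the sup norm.  It induces the usual topology
   and the usual bounded sets, so open, closure, connected, continuous and
   bounded_set are used unchanged, but distances, balls and lengths are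
   Euclidean and are defined here. *)
Definition enorm x : R := Num.sqrt (\sum_(i < n) x ord0 i ^+ 2).

Definition eball x (r : R) : set Rn := [set y | enorm (y - x) < r].

Definition boundary A : set Rn := closure A `\` A°.

Definition rho Omega x : R := inf [set enorm (x - y) | y in boundary Omega].

Definition domain Omega : Prop :=
  [/\ Omega !=set0, open Omega, connected Omega & Omega <> setT].

Definition components A : set (set Rn) := [set connected_component A x | x in A].

(* Lebesgue (outer) measure: infimum of the total volumes of countable covers
   by closed boxes.  It agrees with Lebesgue measure on measurable sets. *)
Definition box (a b : Rn) : set Rn :=
  [set x | forall i, a ord0 i <= x ord0 i <= b ord0 i].

Definition box_volume (a b : Rn) : R := \prod_(i < n) (b ord0 i - a ord0 i).

Definition box_cover A (a b : nat -> Rn) : Prop :=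
  (forall k i, a k ord0 i <= b k ord0 i) /\
  A `<=` \bigcup_k box (a k) (b k).

Definition lebesgue A : \bar R :=
  ereal_inf [set (\sum_(0 <= k <oo) (box_volume (ab.1 k) (ab.2 k))%:E)%E
            | ab in [set ab : (nat -> Rn) * (nat -> Rn)
                    | box_cover A ab.1 ab.2]].

(* A curve [0, l] -> Omega; the values of g outside [0, l] are irrelevant. *)
Definition curve_in Omega (l : R) g : Prop :=
  {within `[0, l], continuous g} /\ (forall t : R, t \in `[0, l] -> Omega (g t)).

(* Vector-valued analogue of the library's [variation]: 0 :: s is a partition
   of [0, t]. *)
Definition polygon_length (t : R) g (s : seq R) : R :=
  let F := g \o nth t (0 :: s) in
  \sum_(0 <= k < size s) enorm (F k.+1 - F k).

Definition curve_length (t : R) g : \bar R :=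
  ereal_sup [set (polygon_length t g s)%:E | s in itv_partition 0 t].

Definition arclength_parametrized (l : R) g : Prop :=
  forall t : R, t \in `[0, l] -> curve_length t g = t%:E.

Definition sep_ball Omega (Cs : R) g (t : R) : set Rn :=
  eball (g t) (Cs * rho Omega (g t)).

(* g is a curve from x to x0 as required in the separation property. *)
Definition separation_curve Omega x0 (Cs : R) x g : Prop :=
  [/\ curve_in Omega 1 g, g 0 = x, g 1 = x0 &
    forall t : R, t \in `[0, 1] ->
      let B := sep_ball Omega Cs g t in
      g @` `[0, t] `<=` B \/
      forall y, (g @` `[0, t] `\` B) y ->
        ~ (exists2 C, components (Omega `\` boundary B) C & C y /\ C x0)].

Definition separation_property Omega x0 (Cs : R) : Prop :=
  forall x, Omega x -> exists g, separation_curve Omega x0 Cs x g.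

Definition separating_ball Omega x0 (Cs : R) B : Prop :=
  exists (x : Rn) (g : R -> Rn) (t : R),
    [/\ Omega x, separation_curve Omega x0 Cs x g, t \in `[0, 1],
        ~ (g @` `[0, t] `<=` B) & B = sep_ball Omega Cs g t].

Definition B_end Omega x0 B : set Rn :=
  \bigcup_(C in components (Omega `\` B) `&` [set C | ~ C x0]) C.

Definition john_domain Omega : Prop :=
  [/\ domain Omega, bounded_set Omega &
    exists x1 : Rn, exists CJ : R,
      [/\ Omega x1, 0 < CJ &
        forall x, Omega x -> exists (l : R) (g : R -> Rn),
          [/\ 0 <= l, curve_in Omega l g, arclength_parametrized l g,
              g 0 = x /\ g l = x1 &
              forall t : R, t \in `[0, l] -> CJ * t <= rho Omega (g t)]]].

End SeparationJohn.

(* Main.v *)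
Require Import Defs.
From HB Require Import structures.
From mathcomp Require Import all_boot all_order all_algebra.
From mathcomp Require Import all_classical all_reals all_analysis.
From mathcomp Require Import measurable_realfun ring lra.
Import Order.TTheory GRing.Theory Num.Theory.
Import numFieldNormedType.Exports.
Local Open Scope classical_set_scope.
Local Open Scope ring_scope.

(* If [Omega] is John with centre [x1] and [B = B(z, Cs r)] with [r = rho z], then a John curve from
   a point of the [B]-end either meets [B], where [rho] is comparable to [r], so that the point lies
   within a multiple of [r] of [z], or it joins the point to [x1] outside [B]; the latter forces
   [x0] or [x1] to lie near [B], so that [r] is bounded below and [Omega], being bounded, lies in a
   multiple of [B].

   Conversely, follow the separation curve [g] from [x] to [x0] and let [p_0 = x, p_1, ...] be the
   successive last exits of [g] from the balls [B(p_i, rho p_i / 2)].  Cubes of size comparable to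
   [rho p_i] around the [p_i] are disjoint, and those around [p_0, ..., p_(k-1)] lie either in a
   multiple of the ball at [p_k] or in its end, so
   [sum_(i < k) (rho p_i)^n <= K (rho p_k)^n].  Hence [rho p_k] grows geometrically in [k] up to
   bounded gaps, so that [sum_(i < k) rho p_i <= C rho p_k], and the polygon through the [p_i],
   parametrized by arclength, is a John curve. *)

(** * The Euclidean norm *)

Section EuclideanNorm.
Context {R : realType} {n : nat}.
Implicit Types (x y : 'rV[R]_n).

Lemma enorm_ge0 x : 0 <= enorm x.
Proof. exact: sqrtr_ge0. Qed.

Lemma sum_sqr_ge0 x : 0 <= \sum_(i < n) x ord0 i ^+ 2.
Proof. by apply: sumr_ge0 => i _; rewrite sqr_ge0. Qed.

Lemma sqr_enorm x : enorm x ^+ 2 = \sum_(i < n) x ord0 i ^+ 2.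
Proof. by rewrite sqr_sqrtr // sum_sqr_ge0. Qed.

Lemma enormZ (a : R) x : enorm (a *: x) = `|a| * enorm x.
Proof.
rewrite /enorm -sqrtr_sqr -sqrtrM ?sqr_ge0 // mulr_sumr; congr (Num.sqrt _).
by apply: eq_bigr => i _; rewrite mxE exprMn.
Qed.

Lemma enormN x : enorm (- x) = enorm x.
Proof. by rewrite -scaleN1r enormZ normrN1 mul1r. Qed.

Lemma enormB x y : enorm (x - y) = enorm (y - x).
Proof. by rewrite -opprB enormN. Qed.

Lemma enorm0 : enorm (0 : 'rV[R]_n) = 0.
Proof. by rewrite -(scale0r 0) enormZ normr0 mul0r. Qed.

Lemma ler_coord_enorm x i : `|x ord0 i| <= enorm x.
Proof.
rewrite -ler_sqr ?nnegrE ?enorm_ge0 // sqr_enorm -normrX ger0_norm ?sqr_ge0 //.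
by rewrite (bigD1 i) //= lerDl sumr_ge0 // => j _; rewrite sqr_ge0.
Qed.

Lemma enorm_eq0 x : enorm x = 0 -> x = 0.
Proof.
move=> x0; apply/rowP => i; rewrite mxE; apply/normr0_eq0/eqP.
by rewrite eq_le normr_ge0 andbT -x0 ler_coord_enorm.
Qed.

(** With [a], [b] the two norms, the sum of the squares [(b x_i - a y_i)^2] equals [2ab] times [ab]
    minus the inner product. Zero norms are treated apart so that [2ab] can be cancelled. *)
Lemma cauchy_schwarz x y :
  \sum_(i < n) x ord0 i * y ord0 i <= enorm x * enorm y.
Proof.
set a := enorm x; set b := enorm y.
have [a0|a_neq0] := eqVneq a 0.
  rewrite a0 mul0r big1 // => i _.
  by rewrite (enorm_eq0 _ a0) mxE mul0r.
have [b0|b_neq0] := eqVneq b 0.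
  rewrite b0 mulr0 big1 // => i _.
  by rewrite (enorm_eq0 _ b0) mxE mulr0.
have ab0 : 0 < a * b by rewrite mulr_gt0 // lt_neqAle eq_sym ?a_neq0 ?b_neq0 enorm_ge0.
have : 0 <= \sum_(i < n) (b * x ord0 i - a * y ord0 i) ^+ 2.
  by apply: sumr_ge0 => i _; rewrite sqr_ge0.
have -> : \sum_(i < n) (b * x ord0 i - a * y ord0 i) ^+ 2 =
    2 * (a * b) * (a * b - \sum_(i < n) x ord0 i * y ord0 i).
  transitivity (b ^+ 2 * \sum_(i < n) x ord0 i ^+ 2 +
      a ^+ 2 * (\sum_(i < n) y ord0 i ^+ 2) +
      (- 2 * (a * b)) * \sum_(i < n) x ord0 i * y ord0 i).
    rewrite !mulr_sumr -!big_split /=.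
    by apply: eq_bigr => i _; ring.
  rewrite -!sqr_enorm -/a -/b; ring.
by rewrite pmulr_rge0 ?subr_ge0 // mulr_gt0.
Qed.

Lemma ler_enormD x y : enorm (x + y) <= enorm x + enorm y.
Proof.
rewrite -ler_sqr ?nnegrE ?addr_ge0 ?enorm_ge0 // sqr_enorm.
rewrite sqrrD !sqr_enorm.
have -> : \sum_(i < n) (x + y) ord0 i ^+ 2 = \sum_(i < n) x ord0 i ^+ 2 +
   (\sum_(i < n) x ord0 i * y ord0 i) *+ 2 + \sum_(i < n) y ord0 i ^+ 2.
  rewrite -sumrMnl -!big_split /=; apply: eq_bigr => i _; rewrite mxE; ring.
by rewrite lerD2r lerD2l ler_pMn2r // cauchy_schwarz.
Qed.

Lemma ler_enorm_tri y x z : enorm (x - z) <= enorm (x - y) + enorm (y - z).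
Proof. by rewrite -[x - z](subrKA y) ler_enormD. Qed.

(** Squared, the sum is at most [n h^2], and [n <= n^2]; the crude factor [n] avoids a square
    root. *)
Lemma enorm_le_coord (h : R) x :
  0 <= h -> (forall i, `|x ord0 i| <= h) -> enorm x <= n%:R * h.
Proof.
move=> h0 xh; rewrite -ler_sqr ?nnegrE ?enorm_ge0 ?mulr_ge0 ?ler0n // sqr_enorm.
apply: (@le_trans _ _ (\sum_(i < n) h ^+ 2)).
  by apply: ler_sum => i _; rewrite -[x ord0 i ^+ 2]ger0_norm ?sqr_ge0 // normrX
    lerXn2r ?nnegrE.
rewrite sumr_const card_ord -[leLHS]mulr_natl exprMn ler_wpM2r ?sqr_ge0 //.
by rewrite -natrX ler_nat; case: (n) => // k; rewrite leq_pmulr.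
Qed.

Lemma norm_le_enorm x : `|x| <= enorm x.
Proof.
rewrite [leLHS]/Num.norm /= mx_normrE; apply/bigmax_leP; split => [|[i j] _ /=].
  exact: enorm_ge0.
by rewrite (ord1 i); exact: ler_coord_enorm.
Qed.

Lemma coord_le_norm x i : `|x ord0 i| <= `|x|.
Proof.
by rewrite [leRHS]/Num.norm /= mx_normrE; apply/bigmax_geP; right; exists (ord0, i).
Qed.

Lemma enorm_le_norm x : enorm x <= n%:R * `|x|.
Proof. by apply: enorm_le_coord => // i; exact: coord_le_norm. Qed.

End EuclideanNorm.

(** * Lebesgue outer measure: packing and scaling *)

Section LebesgueOuter.
Context {R : realType} {n : nat}.
Implicit Types (A B : set 'rV[R]_n) (x y : 'rV[R]_n).

Lemma integral_scaled_indic_itv (w a b : R) : 0 <= w -> a <= b ->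
  (\int[lebesgue_measure]_(u in [set: R]) (w * \1_(`[a, b]%classic : set R) u)%:E
   = (w * (b - a))%:E)%E.
Proof.
move=> w0 ab; under eq_integral do rewrite EFinM.
have mi : measurable_fun [set: R]
      (fun u : R => (\1_(`[a, b]%classic : set R) u)%:E : \bar R).
  by apply/measurable_EFinP; exact: measurable_indic.
rewrite ge0_integralZl //.
transitivity (w%:E * lebesgue_measure (`[a, b]%classic : set R))%E.
  by rewrite integral_indic // setIT.
rewrite lebesgue_measure_itv /= lte_fin EFinM.
by case: ltgtP ab => // -> _; rewrite subrr.
Qed.

(** Integrate the pointwise inequality in [u]; nonnegativity lets the integral pass through the
    series. *)
Lemma integrate_indic_le (N : nat) (w c d : 'I_N -> R) (v a b : nat -> R) :
  (forall j, 0 <= w j) -> (forall j, c j <= d j) ->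
  (forall k, 0 <= v k) -> (forall k, a k <= b k) ->
  (forall u : R, ((\sum_(j < N) w j * \1_(`[c j, d j]%classic : set R) u)%:E <=
     \sum_(0 <= k <oo) (v k * \1_(`[a k, b k]%classic : set R) u)%:E)%E) ->
  ((\sum_(j < N) w j * (d j - c j))%:E <=
     \sum_(0 <= k <oo) (v k * (b k - a k))%:E)%E.
Proof.
move=> w0 cd v0 ab le_wv.
have mf (t p q : R) : measurable_fun [set: R]
    (fun u => (t * \1_(`[p, q]%classic : set R) u)%:E).
  by apply/measurable_EFinP; apply: measurable_funM => //; exact: measurable_indic.
have f0 (t p q u : R) : 0 <= t -> (0 <= (t * \1_(`[p, q]%classic : set R) u)%:E)%E.
  by move=> t0; rewrite lee_fin mulr_ge0.
have -> : ((\sum_(j < N) w j * (d j - c j))%:E =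
    \int[lebesgue_measure]_(u in [set: R])
      (\sum_(j < N) (w j * \1_(`[c j, d j]%classic : set R) u)%:E))%E.
  rewrite ge0_integral_sum //; last 2 first.
  - by move=> j; exact: mf.
  - by move=> j u _; exact: f0.
  rewrite -sumEFin; apply: eq_bigr => j _.
  by rewrite integral_scaled_indic_itv.
have -> : (\sum_(0 <= k <oo) (v k * (b k - a k))%:E =
    \int[lebesgue_measure]_(u in [set: R])
      (\sum_(0 <= k <oo) (v k * \1_(`[a k, b k]%classic : set R) u)%:E))%E.
  rewrite integral_nneseries //; last 2 first.
  - by move=> k; exact: mf.
  - by move=> k u _; exact: f0.
  by apply: eq_eseriesr => k _; rewrite integral_scaled_indic_itv.
apply: ge0_le_integral => //.
- by move=> u _; apply: sume_ge0 => j _; exact: f0.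
- by apply: emeasurable_sum => j; exact: mf.
- by apply: ge0_emeasurable_sum => [k u _ _|k _]; [exact: f0|exact: mf].
- by move=> u _; rewrite sumEFin.
Qed.

(* Interpolates between the indicator of a box ([D = 0]) and its volume ([D = n]): each step
   integrates out one coordinate against one-dimensional Lebesgue measure. *)
Definition partial_volume (D : nat) (c d x : 'rV[R]_n) : R :=
  \prod_(i < n) (if (i < D)%N then d ord0 i - c ord0 i
                 else \1_(`[c ord0 i, d ord0 i]%classic : set R) (x ord0 i)).

Definition is_box (c d : 'rV[R]_n) := forall i, c ord0 i <= d ord0 i.

Lemma partial_volume0 c d x : partial_volume 0 c d x = \1_(box c d) x.
Proof.
rewrite /partial_volume /= [RHS]indicE.
case: (asboolP (box c d x)) => [bx|nbx].
  rewrite mem_set // big1 // => i _; rewrite indicE mem_set //= in_itv; exact: bx.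
have [i] : exists i, ~ c ord0 i <= x ord0 i <= d ord0 i by apply/existsNP.
move=> xi; rewrite memNset // (bigD1 i) //= indicE memNset ?mul0r //=.
Qed.

Lemma partial_volumeT c d x : partial_volume n c d x = box_volume c d.
Proof. by apply: eq_bigr => i _; rewrite ltn_ord. Qed.

(** [w] is the product of the factors with index other than [D]; none of them involves coordinate
    [D] of the point. *)
Lemma partial_volume_step (D : 'I_n) c d x : exists2 w : R,
  is_box c d -> 0 <= w & forall u : R,
  partial_volume D c d (\row_i (if i == D then u else x ord0 i)) =
     w * \1_(`[c ord0 D, d ord0 D]%classic : set R) u /\
  partial_volume D.+1 c d x = w * (d ord0 D - c ord0 D).
Proof.
exists (\prod_(i < n | i != D) (if (i < D)%N then d ord0 i - c ord0 i
          else \1_(`[c ord0 i, d ord0 i]%classic : set R) (x ord0 i))).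
  by move=> cd; apply: prodr_ge0 => i _; case: ifP; rewrite ?subr_ge0.
move=> u; rewrite /partial_volume (bigD1 D) //= [in X in _ /\ X](bigD1 D) //= ltnn ltnSn mxE eqxx.
split; rewrite mulrC; congr (_ * _); apply: eq_bigr => i iD.
  by rewrite mxE (negbTE iD).
have iD' : (val i == val D) = false by exact/negbTE.
by rewrite ltnS leq_eqVlt iD'.
Qed.

(** Fubini by hand: in the induction on [D], the inequality for [D] is taken at [x] with coordinate
    [D] replaced by [u] and then integrated in [u]. *)
Lemma le_volume_box_cover (N : nat) (c d : 'I_N -> 'rV[R]_n) (a b : nat -> 'rV[R]_n) :
  (forall j, is_box (c j) (d j)) -> (forall k, is_box (a k) (b k)) ->
  (forall x : 'rV[R]_n, ((\sum_(j < N) (\1_(box (c j) (d j)) x : R))%:E <=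
     \sum_(0 <= k <oo) (\1_(box (a k) (b k)) x : R)%:E)%E) ->
  ((\sum_(j < N) box_volume (c j) (d j))%:E <=
     \sum_(0 <= k <oo) (box_volume (a k) (b k))%:E)%E.
Proof.
move=> cd ab le0.
suff main D : (D <= n)%N -> forall x,
    ((\sum_(j < N) partial_volume D (c j) (d j) x)%:E <=
     \sum_(0 <= k <oo) (partial_volume D (a k) (b k) x)%:E)%E.
  have := main n (leqnn n) 0.
  under eq_bigr do rewrite partial_volumeT.
  by under eq_eseriesr do rewrite partial_volumeT.
elim: D => [_ x|D IH Dn x].
  under eq_bigr do rewrite partial_volume0.
  by under eq_eseriesr do rewrite partial_volume0.
pose D' := Ordinal Dn.
have [w w0 wE] : exists2 w : 'I_N -> R, forall j, 0 <= w j & forall j u,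
  partial_volume D (c j) (d j) (\row_i (if i == D' then u else x ord0 i)) =
     w j * \1_(`[c j ord0 D', d j ord0 D']%classic : set R) u /\
  partial_volume D.+1 (c j) (d j) x = w j * (d j ord0 D' - c j ord0 D').
  exists (fun j => s2val (cid2 (partial_volume_step D' (c j) (d j) x))) => j;
    by case: cid2 => //= w ? wP; auto.
have [v v0 vE] : exists2 v : nat -> R, forall k, 0 <= v k & forall k u,
  partial_volume D (a k) (b k) (\row_i (if i == D' then u else x ord0 i)) =
     v k * \1_(`[a k ord0 D', b k ord0 D']%classic : set R) u /\
  partial_volume D.+1 (a k) (b k) x = v k * (b k ord0 D' - a k ord0 D').
  exists (fun k => s2val (cid2 (partial_volume_step D' (a k) (b k) x))) => k;
    by case: cid2 => //= w' ? wP; auto.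
under eq_bigr => j _ do rewrite (wE j 0).2.
under eq_eseriesr => k _ do rewrite (vE k 0).2.
apply: integrate_indic_le => // [j|k|u]; [exact: cd|exact: ab|].
have := IH (ltnW Dn) (\row_i (if i == D' then u else x ord0 i)).
under eq_bigr => j _ do rewrite (wE j u).1.
by under eq_eseriesr => k _ do rewrite (vE k u).1.
Qed.

Lemma lebesgue_le A B : A `<=` B -> (lebesgue A <= lebesgue B)%E.
Proof.
move=> AB; apply: ereal_inf_le_tmp => _ [ab [ab0 Bab] <-]; exists ab => //.
by split => // x /AB /Bab.
Qed.

Lemma box_volume_ge0 a b : is_box a b -> 0 <= box_volume a b.
Proof. by move=> ab; apply: prodr_ge0 => i _; rewrite subr_ge0. Qed.

(* Prepending [box p q] to a cover of [A] avoids proving subadditivity of [lebesgue]. *)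
Lemma packing (N : nat) (c d : 'I_N -> 'rV[R]_n) A p q :
  (forall j, is_box (c j) (d j)) -> is_box p q ->
  trivIset setT (fun j => box (c j) (d j)) ->
  (forall j, box (c j) (d j) `<=` A `|` box p q) ->
  ((\sum_(j < N) box_volume (c j) (d j))%:E <= lebesgue A + (box_volume p q)%:E)%E.
Proof.
move=> cd pq triv sub; rewrite -leeBlDr //.
apply: le_ereal_inf_tmp => _ [[a b] [/= ab Aab] <-].
rewrite EFinN leeBlDr //.
pose a' k := if k is k'.+1 then a k' else p.
pose b' k := if k is k'.+1 then b k' else q.
have ab' k : is_box (a' k) (b' k) by case: k => //= k i; exact: ab.
have -> : (\sum_(0 <= k <oo) (box_volume (a k) (b k))%:E + (box_volume p q)%:E =
   \sum_(0 <= k <oo) (box_volume (a' k) (b' k))%:E)%E.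
  rewrite [RHS]nneseries_recl //=; last first.
    by move=> k _; rewrite lee_fin box_volume_ge0.
  rewrite addeC; congr (_ + _)%E.
  rewrite -(nneseries_addn 1) //; last first.
    by move=> k; rewrite lee_fin box_volume_ge0.
  by apply: eq_eseriesr => k _; rewrite addn1.
apply: le_volume_box_cover => // x.
(* By disjointness the left side is 0 or 1. If it is 1, then [x] lies in [A] or in [box p q], hence
   in some box of the extended cover. *)
have [[j xj]|nx] := pselect (exists j, box (c j) (d j) x); last first.
  rewrite big1 => [|j _].
    by apply: nneseries_ge0 => k _ _; rewrite lee_fin.
  by rewrite indicE memNset // => xj; apply: nx; exists j.
rewrite (bigD1 j) //= big1 => [|j' j'j]; last first.
  rewrite indicE memNset // => xj'; move/eqP: j'j; apply.
  by apply: (triv j' j) => //; exists x.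
rewrite addr0 indicE mem_set //.
have [k xk] : exists k, box (a' k) (b' k) x.
  have [/Aab [k _ xk]|xpq] := sub j x xj; [by exists k.+1|by exists 0%N].
rewrite (@nneseriesD1 _ _ k xpredT) //.
rewrite indicE mem_set //.
by rewrite leeDl // nneseries_ge0 // => i _ _; rewrite lee_fin.
Qed.

Lemma lebesgue_box_le c d : (0 < n)%N -> is_box c d ->
  (lebesgue (box c d) <= (box_volume c d)%:E)%E.
Proof.
move=> n0 cd; apply: ge_ereal_inf.
(* All boxes after the first are the single point [c], of volume 0 because [n > 0]. *)
pose a (k : nat) := c; pose b k := if k is 0%N then d else c.
exists (\sum_(0 <= k <oo) (box_volume (a k) (b k))%:E)%E.
  exists (a, b) => //; split => [k i|x xcd] /=.
    by case: k => [|k] //=; exact: cd.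
  by exists 0%N.
rewrite (nneseries_split 0 1) //; last first.
  by move=> k _; rewrite lee_fin box_volume_ge0 // => i; case: k.
rewrite big_nat1 /= eseries0 ?adde0 // => k k1 _.
rewrite /b; case: k k1 => // k _.
by rewrite /box_volume (bigD1 (Ordinal n0)) //= subrr mul0r.
Qed.

(** Dilating a box cover of [A] by [K] about [z] gives a cover of [B] and multiplies every volume by
    [K ^+ n]. *)
Lemma lebesgue_scale A B (K : R) (z : 'rV[R]_n) : 0 < K ->
  (forall x, B x -> A (z + K^-1 *: (x - z))) ->
  (lebesgue B <= (K ^+ n)%:E * lebesgue A)%E.
Proof.
move=> K0 BA.
have Kn : 0 < K ^+ n by rewrite exprn_gt0.
rewrite -lee_pdivrMl //.
apply: le_ereal_inf_tmp => _ [[a b] [/= ab Aab] <-].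
rewrite lee_pdivrMl //.
rewrite -nneseriesZl //; last first.
  by move=> k _; rewrite lee_fin box_volume_ge0 // => i; exact: ab.
pose f x := z + K *: (x - z).
apply: ge_ereal_inf; exists (\sum_(0 <= k <oo) (box_volume (f (a k)) (f (b k)))%:E)%E.
  exists (fun k => f (a k), fun k => f (b k)) => //; split => /= [k i|x /BA /Aab].
    by rewrite !mxE lerD2l ler_pM2l // lerD2r.
  move=> [k _ xk]; exists k => // i; have := xk i; rewrite !mxE => xki.
  have xE : x ord0 i = z ord0 i + K * ((z ord0 i + K^-1 * (x ord0 i - z ord0 i)) - z ord0 i).
    by rewrite addrAC subrr add0r mulrA mulfV ?gt_eqF // mul1r addrC subrK.
  rewrite xE; move: xki; set t := z ord0 i + _ => /andP[h1 h2].
  by rewrite !lerD2l !ler_pM2l // !lerD2r h1 h2.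
apply: lee_nneseries => k _ => [_|]; first by rewrite lee_fin box_volume_ge0 // => i;
  rewrite !mxE lerD2l ler_pM2l // lerD2r.
rewrite -EFinM lee_fin /box_volume -[X in _ <= K ^+ X * _](card_ord n) -prodr_const -big_split /=.
by rewrite le_eqVlt; apply/orP; left; apply/eqP; apply: eq_bigr => i _; rewrite !mxE; ring.
Qed.

End LebesgueOuter.

(** * The distance to the boundary *)

Section BoundaryDistance.
Context {R : realType} {n : nat}.
Implicit Types (A B Omega : set 'rV[R]_n) (x y z : 'rV[R]_n).

Lemma nbhs_eballP x A : nbhs x A <-> exists2 e : R, 0 < e & eball x e `<=` A.
Proof.
split=> [/nbhs_normP [e /= e0 eA]|[e e0 eA]].
  exists e => // y xy; apply: eA => /=.
  by rewrite /ball_ /= distrC (le_lt_trans (norm_le_enorm _)).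
(* [n.+1] rather than [n] keeps the radius positive when [n = 0]. *)
apply: (nbhs_normP x A).2; exists (e / n.+1%:R) => /=; first by rewrite divr_gt0.
move=> y /= xy; apply: eA; rewrite /eball /= enormB.
apply: (le_lt_trans (enorm_le_norm _)).
rewrite ltr_pdivlMr // in xy; apply: le_lt_trans xy.
by rewrite mulrC ler_wpM2l // ler_nat.
Qed.

Lemma eball_center x (e : R) : 0 < e -> eball x e x.
Proof. by move=> e0; rewrite /eball /= subrr enorm0. Qed.

Lemma open_eball x (e : R) : open (eball x e).
Proof.
rewrite openE => y xy; apply/nbhs_eballP; exists (e - enorm (y - x)).
  by rewrite subr_gt0.
move=> w; rewrite /eball /= ltrBrDr; apply: le_lt_trans.
exact: ler_enorm_tri.
Qed.

Lemma continuous_enorm_dist x : continuous (fun y => enorm (y - x) : R).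
Proof.
move=> y; apply/(@cvgrPdist_lt _ _ _ (nbhs y)) => e e0; apply/nbhs_eballP; exists e => // w yw.
rewrite /= ltr_norml; have h1 := ler_enorm_tri w y x; have h2 := ler_enorm_tri y w x.
by rewrite /eball /= in yw; rewrite (enormB y w) in h1; lra.
Qed.

Lemma boundary_eball_sub x (e : R) y : boundary (eball x e) y -> enorm (y - x) = e.
Proof.
move=> [cly]; rewrite (interior_id _).1; last exact: open_eball.
rewrite /eball /= => /negP; rewrite -leNgt => le_e; apply/eqP; rewrite eq_le le_e andbT.
have cl : closed [set w | enorm (w - x) <= e].
  rewrite (_ : mkset _ = (fun w => enorm (w - x)) @^-1` [set u | u <= e]) //.
  by apply: closed_comp => [w _|]; [exact: continuous_enorm_dist|exact: closed_le].
by apply: cl; apply: closureS cly => w /ltW.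
Qed.

Definition line x y (u : R) := x + u *: (y - x).

Lemma continuous_line x y : continuous (line x y).
Proof.
move=> u; apply: cvgD; first exact: cvg_cst.
by apply: cvgZr_tmp; exact: cvg_id.
Qed.

Definition segment x y : set 'rV[R]_n := line x y @` `[0, 1].

Lemma connected_segment x y : connected (segment x y).
Proof.
apply: connected_continuous_connected; first exact: segment_connected.
by apply: continuous_subspaceT; exact: continuous_line.
Qed.

Lemma segment_l x y : segment x y x.
Proof. by exists 0; rewrite /line ?scale0r ?addr0 //= in_itv /= lexx ler01. Qed.

Lemma segment_r x y : segment x y y.
Proof. by exists 1; rewrite /line ?scale1r ?subrKC //= in_itv /= lexx ler01. Qed.

(** Away from the boundary, the interior and the closure of [A] have the same trace on [C] as [A],
    so this trace is open and closed in [C]. *)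
Lemma connected_boundary A C :
  connected C -> (C `&` A) !=set0 -> C `&` boundary A = set0 -> C `<=` A.
Proof.
move=> cC CA0 CbA0.
have : C `&` A = C.
  apply: cC => //.
  - exists A°; first exact: open_interior.
    rewrite eqEsubset; split=> w [Cw Aw]; split => //; last exact: interior_subset.
    apply: contrapT => nAw; suff : (C `&` boundary A) w by rewrite CbA0.
    by split => //; split => //; apply: subset_closure.
  - exists (closure A); first exact: closed_closure.
    rewrite eqEsubset; split=> w [Cw Aw]; split => //; first exact: subset_closure.
    apply: contrapT => nAw; suff : (C `&` boundary A) w by rewrite CbA0.
    by split => //; split => // /interior_subset.
by move=> <- w [].
Qed.

Section Rho.
Variable Omega : set 'rV[R]_n.
Hypothesis dOmega : domain Omega.

(** Otherwise segments starting in [Omega] could never leave it, and [Omega] would be the whole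
    space. *)
Lemma boundary_neq0 : boundary Omega !=set0.
Proof.
have [Om0 oOm _ nT] := dOmega; apply: contrapT => /nonemptyPn b0.
have [x Ox] := Om0; apply: nT; rewrite -subTset => y _.
apply: (@connected_boundary Omega (segment x y)) => //; last exact: segment_r.
- exact: connected_segment.
- by exists x; split => //; exact: segment_l.
- by rewrite b0 setI0.
Qed.

(** Ensures that the [inf] in [rho] is a true infimum and not a default value. *)
Lemma rho_has_inf x : has_inf [set enorm (x - y) | y in boundary Omega].
Proof.
split; first by have [w bw] := boundary_neq0; exists (enorm (x - w)), w.
by exists 0 => _ [w _ <-]; exact: enorm_ge0.
Qed.

Lemma rho_le_boundary x w : boundary Omega w -> rho Omega x <= enorm (x - w).
Proof. by move=> bw; apply: ge_inf; [exact: (rho_has_inf x).2|exists w]. Qed.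

Lemma rho_lipschitz x y : rho Omega x <= rho Omega y + enorm (x - y).
Proof.
rewrite -lerBlDr; apply: lb_le_inf; first exact: (rho_has_inf y).1.
move=> _ [w bw <-]; rewrite lerBlDl.
by apply: le_trans (rho_le_boundary x w bw) _; exact: ler_enorm_tri.
Qed.

(** The segment from [x] to a point of the ball is too short to reach the boundary. *)
Lemma eball_rho_sub x : Omega x -> eball x (rho Omega x) `<=` Omega.
Proof.
move=> Ox y xy.
apply: (@connected_boundary Omega (segment x y)); last exact: segment_r.
- exact: connected_segment.
- by exists x; split => //; exact: segment_l.
- rewrite -subset0 => w [[u /= /andP[u0 u1] <-]] /(rho_le_boundary x).
  rewrite !bnd_simp in u0 u1.
  rewrite /line opprD addNKr enormN enormZ ger0_norm // leNgt => /negP; apply.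
  by apply: le_lt_trans xy; rewrite ler_piMl // enorm_ge0.
Qed.

Lemma rho_gt0 x : Omega x -> 0 < rho Omega x.
Proof.
move=> Ox; have [_ oOm _ _] := dOmega.
have /nbhs_eballP [e e0 eO] : nbhs x Omega by exact: open_nbhs_nbhs.
apply: (lt_le_trans e0); apply: lb_le_inf; first exact: (rho_has_inf x).1.
move=> _ [w [_ nw] <-]; rewrite leNgt; apply/negP => xw; apply: nw.
by rewrite (interior_id _).1 //; apply: eO; rewrite /eball /= enormB.
Qed.

Lemma continuous_rho : continuous (rho Omega).
Proof.
move=> y; apply/(@cvgrPdist_lt _ _ _ (nbhs y)) => e e0; apply/nbhs_eballP; exists e => // w yw.
rewrite /= ltr_norml; have h1 := rho_lipschitz y w; have h2 := rho_lipschitz w y.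
by rewrite /eball /= in yw; rewrite (enormB y w) in h1; lra.
Qed.

End Rho.
End BoundaryDistance.

(** * Ends of a ball *)

Section BallEnds.
Context {R : realType} {n : nat}.
Implicit Types (C D Omega : set 'rV[R]_n) (x y z : 'rV[R]_n).
Variable Omega : set 'rV[R]_n.
Hypothesis dOmega : domain Omega.

(* The separation property speaks of components of [Omega \ bd B], ends of components of
   [Omega \ B].  Pushing points radially outwards by half their distance to the boundary moves a
   connected subset of [Omega \ B] off the sphere without leaving [Omega]. *)
Definition push_factor z x := rho Omega x / 2 / enorm (x - z).

Definition push z x := x + push_factor z x *: (x - z).

Lemma push_factor_ge0 z x : Omega x -> 0 <= push_factor z x.
Proof.
by move=> /(rho_gt0 _ dOmega) /ltW Ox; rewrite !mulr_ge0 // invr_ge0 enorm_ge0.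
Qed.

Lemma line_push z x u : line x (push z x) u = x + (u * push_factor z x) *: (x - z).
Proof. by rewrite /line /push [_ + _ - x]addrAC subrr add0r scalerA. Qed.

Lemma line_push_in z x u : Omega x -> 0 < enorm (x - z) -> 0 <= u <= 1 ->
  Omega (line x (push z x) u).
Proof.
move=> Ox xz /andP[u0 u1]; have rx := rho_gt0 _ dOmega _ Ox.
apply: (eball_rho_sub _ dOmega x) => //; rewrite /eball /= line_push.
rewrite [_ + _ - x]addrAC subrr add0r enormZ ger0_norm; last first.
  by rewrite mulr_ge0 // push_factor_ge0.
rewrite /push_factor !mulrA divfK ?gt_eqF // ltr_pdivrMr //.
by rewrite (@le_lt_trans _ _ (rho Omega x)) ?ler_piMl // ?ltW //; lra.
Qed.

Lemma enorm_line_push z x u : Omega x -> 0 <= u ->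
  enorm (line x (push z x) u - z) = (1 + u * push_factor z x) * enorm (x - z).
Proof.
move=> Ox u0; rewrite line_push addrAC -{1}[x - z]scale1r -scalerDl enormZ.
by rewrite ger0_norm // addr_ge0 // mulr_ge0 // push_factor_ge0.
Qed.

(** Pushing increases the distance to [z] by exactly [rho Omega x / 2], so a weak inequality becomes
    strict. *)
Lemma push_far z x (r : R) : 0 < r -> Omega x -> r <= enorm (x - z) ->
  r < enorm (push z x - z).
Proof.
move=> r0 Ox rx; have xz : 0 < enorm (x - z) by exact: lt_le_trans rx.
have -> : push z x = line x (push z x) 1 by rewrite line_push mul1r.
rewrite enorm_line_push // mul1r mulrDl mul1r /push_factor divfK ?gt_eqF //.
by have := rho_gt0 _ dOmega _ Ox; lra.
Qed.

Lemma continuous_push z x : x != z -> {for x, continuous (push z)}.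
Proof.
move=> xz; have e0 : enorm (x - z) != 0.
  by apply: contra_neq xz => /enorm_eq0 /eqP; rewrite subr_eq0 => /eqP.
apply: (@cvgD _ _ _ (nbhs x) _ id (fun w => push_factor z w *: (w - z))).
  exact: cvg_id.
apply: cvgZ; last by apply: cvgB; [exact: cvg_id|exact: cvg_cst].
apply: cvgM; first by apply: cvgM; [exact: continuous_rho|exact: cvg_cst].
by apply: cvgV => //; exact: continuous_enorm_dist.
Qed.

(** [C'] is the pushed copy of [C] together with the segments from [x] and [y] to their pushes. All
    its points lie strictly farther than [r] from [z]: on the image by [push_far], on the segments
    because [x] and [y] are already strictly outside. *)
Lemma connected_push z (r : R) C x y : 0 < r -> connected C ->
  C `<=` Omega `\` eball z r -> C x -> C y ->
  r < enorm (x - z) -> r < enorm (y - z) ->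
  exists C', [/\ connected C', C' `<=` Omega `\` boundary (eball z r), C' x & C' y].
Proof.
move=> r0 cC CO Cx Cy rx ry.
have rC w : C w -> Omega w /\ r <= enorm (w - z).
  by move=> /CO [Ow nw]; split => //; rewrite leNgt; exact/negP.
have cseg w : C w -> connected (push z @` C `|` segment w (push z w)).
  move=> Cw; apply: connectedU; last exact: connected_segment.
  - by exists (push z w); split; [exists w|exact: segment_r].
  - apply: connected_continuous_connected => //.
    apply: continuous_in_subspaceT => v /set_mem /rC [_ rv].
    apply: continuous_push; apply: contraTneq rv => ->.
    by rewrite subrr enorm0 -ltNge.
exists ((push z @` C `|` segment x (push z x)) `|` (push z @` C `|` segment y (push z y))).
split; [|move=> w; rewrite -setUUr|by left; right; exact: segment_l|
  by right; right; exact: segment_l].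
  apply: connectedU; [|exact: cseg|exact: cseg].
  by exists (push z x); split; left; exists x.
suff far v : Omega v -> r < enorm (v - z) -> (Omega `\` boundary (eball z r)) v.
  have seg v : Omega v -> r < enorm (v - z) ->
      segment v (push z v) `<=` (Omega `\` boundary (eball z r)).
    move=> Ov rv _ [u /= u01 <-]; rewrite in_itv /= in u01; have /andP[u0 _] := u01.
    apply: far; first by apply: line_push_in => //; exact: lt_trans rv.
    rewrite enorm_line_push //; apply: lt_le_trans rv _.
    by rewrite ler_peMl ?enorm_ge0 // lerDl mulr_ge0 // push_factor_ge0.
  move=> [[v Cv <-]|[|]]; [|apply: seg => //|apply: seg => //].
  - have [Ov rv] := rC _ Cv; apply: far; last exact: push_far.
    have -> : push z v = line v (push z v) 1 by rewrite line_push mul1r.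
    by apply: line_push_in => //; [exact: lt_le_trans rv|rewrite ler01 lexx].
  - by have [] := rC _ Cx.
  - by have [] := rC _ Cy.
by move=> Ov rv; split => // /boundary_eball_sub E; rewrite E ltxx in rv.
Qed.

(** If the component of [Omega] minus the ball that contains [D] also contained [x0],
    [connected_push] would join [y] to [x0] off the sphere, against the separation hypothesis. *)
Lemma sub_B_end x0 z (r : R) D y : 0 < r -> Omega x0 ->
  connected D -> D y -> D `<=` Omega `\` eball z r ->
  r < enorm (y - z) -> r < enorm (x0 - z) ->
  ~ (exists2 C, components (Omega `\` boundary (eball z r)) C & C y /\ C x0) ->
  D `<=` B_end Omega x0 (eball z r).
Proof.
move=> r0 Ox0 cD Dy DO ry rx0 sep w Dw.
exists (connected_component (Omega `\` eball z r) y); last first.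
  exact: (connected_component_max Dy DO cD).
split; first by exists y => //; exact: DO.
move=> Cx0; apply: sep.
have [C' [cC' C'O C'y C'x0]] := connected_push z r _ y x0 r0
  (@component_connected _ (Omega `\` eball z r) y) (@connected_component_sub _ _ _)
  (connected_component_refl (DO _ Dy)) Cx0 ry rx0.
exists (connected_component (Omega `\` boundary (eball z r)) y).
  by exists y => //; exact: C'O.
split; first by apply: connected_component_refl; exact: C'O.
exact: (connected_component_max C'y C'O cC').
Qed.

(** No component of the complement of [B] contains [x0], so all of them belong to the end. *)
Lemma B_end_center x0 (B : set 'rV[R]_n) : B x0 -> Omega `\` B `<=` B_end Omega x0 B.
Proof.
move=> Bx0 y OBy; exists (connected_component (Omega `\` B) y).
  by split => /=; [exists y|move=> /connected_component_sub []].
exact: connected_component_refl.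
Qed.

End BallEnds.

(** * Axis-parallel cubes *)

Section Cubes.
Context {R : realType} {n : nat}.
Implicit Types (x y z : 'rV[R]_n) (h : R).

Definition cube z h : set 'rV[R]_n := box (z - const_mx h) (z + const_mx h).

Lemma cubeP z h y : cube z h y <-> forall i, `|y ord0 i - z ord0 i| <= h.
Proof.
by split=> zy i; have := zy i; rewrite !mxE ler_distl.
Qed.

Lemma cube_volume z h : box_volume (z - const_mx h) (z + const_mx h) = (2 * h) ^+ n.
Proof.
rewrite /box_volume -[in RHS](card_ord n) -prodr_const.
by apply: eq_bigr => i _; rewrite !mxE; ring.
Qed.

Lemma cube_segment z h y : cube z h y -> segment z y `<=` cube z h.
Proof.
move=> /cubeP zy _ [u /= u01 <-]; apply/cubeP => i.
rewrite in_itv /= in u01; have /andP[u0 u1] := u01.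
rewrite !mxE addrAC subrr add0r normrM ger0_norm //.
by apply: le_trans (zy i); rewrite ler_piMl.
Qed.

Lemma cube_enorm z h y : 0 <= h -> cube z h y -> enorm (y - z) <= n%:R * h.
Proof. by move=> h0 /cubeP zy; apply: enorm_le_coord => // i; rewrite !mxE. Qed.

Lemma eball_sub_cube z h : eball z h `<=` cube z h.
Proof.
move=> y /ltW zy; apply/cubeP => i; apply: le_trans zy.
by have := ler_coord_enorm (y - z) i; rewrite !mxE.
Qed.

End Cubes.

(** * Sequences whose power sums are controlled by the next term *)

Section PowerSums.
Context {R : realType}.
Implicit Types (a : nat -> R) (K C : R) (n m : nat).

(** Each [k] with [i <= k < i + m] satisfies [a_i^n <= K a_k^n]: for [k > i] since [a_i^n] is a term
    of the sum up to [k], for [k = i] since [K >= 1]. Add these [m] inequalities. *)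
Lemma power_sum_ge n K a i m : 1 <= K -> (forall j, 0 <= a j) ->
  (forall k, (i < k < i + m)%N -> \sum_(j < k) a j ^+ n <= K * a k ^+ n) ->
  m%:R * a i ^+ n <= K * \sum_(j < i + m) a j ^+ n.
Proof.
move=> K1 a0 aK; have K0 : 0 <= K by exact: le_trans K1.
rewrite mulr_sumr -(big_mkord xpredT (fun j => K * a j ^+ n)).
rewrite (@big_cat_nat _ _ _ i) ?leq_addr //=.
apply: ler_wpDl; first by apply: sumr_ge0 => j _; rewrite mulr_ge0 // exprn_ge0.
rewrite mulr_natl -[in leLHS](addKn i m) -sumr_const_nat ler_sum_nat // => k /andP[ik kim].
have [->|ik'] := eqVneq k i; first by rewrite ler_peMl // exprn_ge0.
have ltik : (i < k)%N by rewrite ltn_neqAle eq_sym ik'.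
apply: le_trans (aK k _); last by rewrite ltik.
rewrite (bigD1 (Ordinal ltik)) //= lerDl.
by apply: sumr_ge0 => j _; rewrite exprn_ge0.
Qed.

Lemma sum_le_of_power_sum n K : (0 < n)%N -> 1 <= K -> exists2 C, 0 < C &
  forall a N, (forall i, 0 <= a i) ->
    (forall k, (k < N)%N -> \sum_(i < k) a i ^+ n <= K * a k ^+ n) ->
    forall k, (k < N)%N -> \sum_(i < k) a i <= C * a k.
Proof.
move=> n0 K1; have K0 : 0 < K by exact: lt_le_trans K1.
(* Terms double after [m] indices: [m a_i^n] is at most [K] times the power sum up to [i + m], hence
   at most [K^2 a_(i+m)^n], while [m >= K^2 2^n]. *)
pose m := (Num.truncn (K ^+ 2 * 2 ^+ n)).+1.
have mK : K ^+ 2 * 2 ^+ n <= m%:R by rewrite ltW // truncnS_gt.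
exists (2 * m%:R * K); first by rewrite !mulr_gt0 // ltr0n.
move=> a N a0 aK.
have aKk k i : (k < N)%N -> (i < k)%N -> a i <= K * a k.
  move=> kN ik; rewrite -(@ler_pXn2r _ n) ?nnegrE ?mulr_ge0 ?a0 ?(ltW K0) //.
  apply: (@le_trans _ _ (K * a k ^+ n)).
    apply: le_trans (aK k kN); rewrite (bigD1 (Ordinal ik)) //= lerDl.
    by apply: sumr_ge0 => j _; rewrite exprn_ge0.
  rewrite exprMn ler_wpM2r ?exprn_ge0 // -{1}[K]expr1.
  by rewrite ler_weXn2l.
have double i : (i + m < N)%N -> 2 * a i <= a (i + m)%N.
  move=> imN; rewrite -(@ler_pXn2r _ n) ?nnegrE ?mulr_ge0 ?a0 //.
  have h1 : m%:R * a i ^+ n <= K * \sum_(j < i + m) a j ^+ n.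
    apply: power_sum_ge => // k /andP[_ kim]; apply: aK; exact: ltn_trans imN.
  have h2 := aK _ imN.
  have h3 : K ^+ 2 * 2 ^+ n * a i ^+ n <= K ^+ 2 * a (i + m)%N ^+ n.
    apply: (@le_trans _ _ (m%:R * a i ^+ n)); first by rewrite ler_wpM2r // exprn_ge0.
    by apply: le_trans h1 _; rewrite expr2 -mulrA ler_wpM2l // ltW.
  by rewrite -mulrA -exprMn ler_pM2l // exprn_gt0 in h3.
(* Split off the last [m] terms. They contribute at most [m K a_k], half of the target; by doubling,
   the induction hypothesis at [k - m] gives the other half. *)
elim/ltn_ind => k IH kN.
have [km|mk] := ltnP k m.
  apply: (@le_trans _ _ (\sum_(i < k) K * a k)).
    by apply: ler_sum => i _; exact: aKk.
  rewrite sumr_const card_ord -[leLHS]mulr_natl mulrA ler_wpM2r ?a0 // ler_wpM2r ?(ltW K0) //.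
  by rewrite -natrM ler_nat (leq_trans (ltnW km)) // leq_pmull.
have kE : k = ((k - m) + m)%N by rewrite subnK.
have km0 : (k - m < k)%N by rewrite ltn_subrL (leq_trans _ mk).
rewrite -(big_mkord xpredT) (@big_cat_nat _ _ _ (k - m)) ?leq_subr //= big_mkord.
have h1 := IH _ km0 (ltn_trans km0 kN).
have h2 : \sum_(k - m <= i < k) a i <= m%:R * K * a k.
  apply: (@le_trans _ _ (\sum_(k - m <= i < k) K * a k)).
    by apply: ler_sum_nat => i /andP[_ ik]; exact: aKk.
  by rewrite sumr_const_nat subKn // -[leLHS]mulr_natl mulrA.
have h3 : 2 * a (k - m)%N <= a k by rewrite {2}kE; apply: double; rewrite -kE.
have h4 : 2 * m%:R * K * a (k - m)%N <= m%:R * K * a k.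
  rewrite (_ : 2 * _ * _ * _ = m%:R * K * (2 * a (k - m)%N)); last by ring.
  by rewrite ler_wpM2l // mulr_ge0 // ltW.
by rewrite (_ : 2 * _ * _ * _ = m%:R * K * a k + m%:R * K * a k); [lra|ring].
Qed.

(** [power_sum_ge] at [i = 0] gives [m a_0^n <= K W] for every [m]. This will force the chain of
    exit points to be finite. *)
Lemma power_sum_unbounded n K W a : 1 <= K -> (forall j, 0 < a j) ->
  (forall k, \sum_(j < k) a j ^+ n <= K * a k ^+ n) ->
  (forall k, \sum_(j < k) a j ^+ n <= W) -> False.
Proof.
move=> K1 a0 aK aW; have K0 : 0 < K by exact: lt_le_trans K1.
have a0n : 0 < a 0%N ^+ n by rewrite exprn_gt0.
pose m := (Num.truncn (K * W / a 0%N ^+ n)).+1.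
have : m%:R * a 0%N ^+ n <= K * W.
  apply: le_trans (_ : K * \sum_(j < 0 + m) a j ^+ n <= _); last by rewrite ler_pM2l.
  by apply: power_sum_ge => // j; exact: ltW.
by rewrite -ler_pdivlMr // leNgt truncnS_gt.
Qed.

End PowerSums.

(** * Arclength-parametrized polygons *)

(** When [f t > c], [u] is the maximum of the compact set of times in [[s, t]] where [f <= c]. *)
Lemma last_exit (R : realType) (f : R -> R) (s t c : R) : s <= t ->
  {within `[s, t], continuous f} -> f s <= c ->
  exists2 u, s <= u <= t & f u <= c /\ (u = t \/ forall v, u <= v <= t -> c <= f v).
Proof.
move=> st cf fs.
have [ft|ft] := leP (f t) c; first by exists t; rewrite ?st ?lexx //; split => //; left.
have [V cV VE] : exists2 V : set R, closed V & V `&` `[s, t] = f @^-1` [set y | y <= c] `&` `[s, t].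
  have cl : closed [set y : R | y <= c] by exact: closed_le.
  have /closed_subspaceP [V cV VE] : closed (f @^-1` [set y | y <= c] : set (subspace `[s, t])).
    exact: (continuous_closedP _).1 cf _ cl.
  by exists V.
have cS : compact (`[s, t] `&` V) by apply: compact_closedI => //; exact: segment_compact.
have SP w : (`[s, t] `&` V) w <-> s <= w <= t /\ f w <= c.
  rewrite setIC VE; split=> [[/= fw]|[stw fw]]; first by rewrite in_itv.
  by split => //=; rewrite in_itv.
have [] := @compact_EVT_max _ _ idfun (`[s, t] `&` V) _ cS.
- by exists s; apply/SP; rewrite lexx st.
- by apply: continuous_subspaceT => w; exact: cvg_id.
move=> u /set_mem /SP [sut fu] umax; exists u => //; split => //; right => v /andP[uv vt].
have /andP[su ut] := sut.
have late w : u < w -> w <= t -> c < f w.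
  move=> uw wt; rewrite ltNge; apply/negP => fw.
  have : w <= u by apply: umax; apply/mem_set/SP; rewrite wt (le_trans su (ltW uw)).
  by rewrite leNgt uw.
have [->|uv'] := eqVneq v u; last first.
  by apply/ltW/late => //; rewrite lt_neqAle eq_sym uv'.
rewrite leNgt; apply/negP => fuc.
have [] := @IVT R f u t c ut.
- by apply: continuous_subspaceW cf => w /=; rewrite !in_itv /= => /andP[uw ->];
    rewrite (le_trans su).
- by rewrite ge_min le_max (ltW fuc) (ltW ft) orbT.
move=> w; rewrite in_itv /= => /andP[uw wt] fw.
have : c < f w.
  apply: late => //; rewrite lt_neqAle uw andbT.
  by apply: contraTneq fuc => ->; rewrite fw ltxx.
by rewrite fw ltxx.
Qed.

Section UnitSpeed.
Context {R : realType} {n : nat}.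
Implicit Types (g : R -> 'rV[R]_n) (l t : R) (s : seq R).

(** A form of [polygon_length] suited to induction on the partition. *)
Fixpoint path_length g (a : R) s : R :=
  if s is b :: s' then enorm (g b - g a) + path_length g b s' else 0.

Lemma polygon_lengthE t g s : polygon_length t g s = path_length g 0 s.
Proof.
suff H a d : \sum_(0 <= k < size s)
    enorm (g (nth d (a :: s) k.+1) - g (nth d (a :: s) k)) = path_length g a s.
  exact: H.
elim: s a => [|b s IH] a; first by rewrite big_nil.
by rewrite /= big_nat_recl //= IH.
Qed.

Lemma path_length_rcons g a s t :
  path_length g a (rcons s t) = path_length g a s + enorm (g t - g (last a s)).
Proof. by elim: s a => [|b s IH] a /=; rewrite ?add0r ?addr0 // IH addrA. Qed.

Lemma path_length_eq g g' a b s : itv_partition a b s ->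
  (forall v, v <= b -> g' v = g v) -> path_length g' a s = path_length g a s.
Proof.
move=> + gg'; elim: s a => //= c s IH a abs.
have cbs := itv_partition_cons abs.
rewrite IH // !gg' //; first exact: itv_partition_le abs.
exact: itv_partition_le cbs.
Qed.

(** A form of arclength parametrization that is easy to extend by a segment: the Lipschitz bound
    gives length at most [t], and a single partition attaining [t] gives equality. *)
Definition unit_speed l g := [/\ 0 <= l,
  forall s t : R, 0 <= s -> s <= t -> t <= l -> enorm (g t - g s) <= t - s &
  forall t : R, 0 <= t <= l -> exists2 s : seq R, itv_partition 0 t s & path_length g 0 s = t].

Lemma path_length_le l g a t s : unit_speed l g -> 0 <= a -> t <= l ->
  itv_partition a t s -> path_length g a s <= t - a.
Proof.
move=> [_ lip _] + tl; elim: s a => [|b s IH] a a0 abs /=.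
  by rewrite (itv_partition_nil abs) subrr.
have bts := itv_partition_cons abs; have bt := itv_partition_le bts.
have ab : a <= b by case: abs => /= /andP[/ltW].
have := IH b (le_trans a0 ab) bts.
have := lip a b a0 ab (le_trans bt tl); lra.
Qed.

Lemma unit_speed_arclength l g : unit_speed l g -> arclength_parametrized l g.
Proof.
move=> us t; rewrite in_itv /= => /andP[t0 tl]; apply/eqP; rewrite eq_le; apply/andP; split.
  apply: ge_ereal_sup => _ [s ts <-]; rewrite lee_fin polygon_lengthE.
  by have := path_length_le _ _ _ _ _ us (lexx 0) tl ts; rewrite subr0.
have [_ _ /(_ t)] := us; rewrite t0 tl => /(_ isT) [s ts st].
by apply: ereal_sup_ubound; exists s => //; rewrite polygon_lengthE st.
Qed.

Lemma unit_speed_continuous l g : unit_speed l g -> {within `[0, l], continuous g}.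
Proof.
move=> [l0 lip _]; apply/subspace_continuousP => t /=.
rewrite in_itv /= => /andP[t0 tl].
apply/cvgrPdist_lt => e e0; rewrite near_withinE; apply/nbhs_ballP.
exists e => //= s ts; rewrite in_itv /= => /andP[s0 sl].
apply: le_lt_trans (norm_le_enorm _) _.
have [st|/ltW st] := leP s t.
  by apply: le_lt_trans (lip s t s0 st tl) (le_lt_trans (ler_norm _) ts).
rewrite enormB; apply: le_lt_trans (lip t s t0 st sl) (le_lt_trans (ler_norm _) _).
by rewrite distrC.
Qed.

Lemma unit_speed_const x : unit_speed 0 (fun=> x : 'rV[R]_n).
Proof.
split=> // [s t s0 st t0|t t0]; first by rewrite subrr enorm0 subr_ge0.
have -> : t = 0 by apply/eqP; rewrite eq_le andbC.
by exists [::].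
Qed.

Lemma unit_speed_extend l g q : unit_speed l g -> exists g',
  [/\ unit_speed (l + enorm (q - g l)) g', forall t, t <= l -> g' t = g t &
      g' (l + enorm (q - g l)) = q].
Proof.
move=> [l0 lip part]; set d := enorm _.
have d0 : 0 <= d by exact: enorm_ge0.
(* For [d = 0] there is no direction to follow, and [g] itself works. *)
have [dE|dn0] := eqVneq d 0.
  exists g; rewrite dE addr0; split => //.
  by apply/eqP; rewrite eq_sym -subr_eq0; apply/eqP/enorm_eq0.
have dgt0 : 0 < d by rewrite lt_neqAle eq_sym dn0.
pose u := d^-1 *: (q - g l).
have u1 : enorm u = 1 by rewrite enormZ ger0_norm ?invr_ge0 // mulVf.
pose g' t := if t <= l then g t else g l + (t - l) *: u.
have g'1 t : t <= l -> g' t = g t by rewrite /g' => ->.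
have g'2 t : l <= t -> g' t = g l + (t - l) *: u.
  rewrite le_eqVlt => /predU1P[<-|lt]; last by rewrite /g' leNgt lt.
  by rewrite g'1 // subrr scale0r addr0.
exists g'; split => //; last first.
  rewrite g'2 ?lerDl // addrAC subrr add0r /u scalerA divff // scale1r addrC subrK //.
split; first exact: addr_ge0.
- move=> s t s0 st tld.
  have [tl|lt] := leP t l.
    by rewrite !g'1 // ?(le_trans st) //; exact: lip.
  have [sl|ls] := leP s l.
    rewrite (g'1 s sl) (g'2 t (ltW lt)).
    apply: le_trans (ler_enorm_tri (g l) _ _) _.
    rewrite addrAC subrr add0r enormZ u1 mulr1 ger0_norm ?subr_ge0 ?(ltW lt) //.
    by have := lip s l s0 sl (lexx l); lra.
  rewrite (g'2 s (ltW ls)) (g'2 t (ltW lt)) opprD addrACA subrr add0r.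
  by rewrite -scalerBl enormZ u1 mulr1 ger0_norm; lra.
- move=> t /andP[t0 tld]; have [tl|lt] := leP t l.
    have [|s ts st] := part t; first by rewrite t0.
    exists s => //; rewrite (path_length_eq g _ _ _ _ ts) // => v vt.
    by rewrite g'1 // (le_trans vt).
  have [|s ls sl] := part l; first by rewrite l0 lexx.
  exists (rcons s t).
    by rewrite -cats1; apply: itv_partition_cat ls _; exact: itv_partition1.
  rewrite path_length_rcons (path_length_eq g _ _ _ _ ls) // sl.
  have [_ /eqP ->] := ls; rewrite (g'1 l (lexx l)) (g'2 t (ltW lt)).
  by rewrite addrAC subrr add0r enormZ u1 mulr1 ger0_norm ?subr_ge0 ?(ltW lt) // addrC subrK.
Qed.

(** On the edge leaving [p N], the distance to the boundary is at least [rho (p N) / 2], while the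
    arclength from the start is at most [(C + 1/2) rho (p N)]; the quotient is the constant
    [(2 * C + 1)^-1]. *)
Lemma polygon_john Omega (p : nat -> 'rV[R]_n) (C : R) N : domain Omega -> 0 < C ->
  Omega (p 0%N) ->
  (forall i, (i < N)%N -> [/\ Omega (p i), enorm (p i.+1 - p i) <= rho Omega (p i) / 2 &
    \sum_(j < i) enorm (p j.+1 - p j) <= C * rho Omega (p i)]) ->
  let l := \sum_(j < N) enorm (p j.+1 - p j) in
  exists g, [/\ unit_speed l g, g 0 = p 0%N, g l = p N &
    forall t, 0 <= t <= l -> Omega (g t) /\ (2 * C + 1)^-1 * t <= rho Omega (g t)].
Proof.
move=> dO C0 O0; elim: N => [_|N IH pN] /=.
  rewrite big_ord0; exists (fun=> p 0%N); split => //; first exact: unit_speed_const.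
  move=> t t0; have -> : t = 0 by apply/eqP; rewrite eq_le andbC.
  by rewrite mulr0 ltW ?rho_gt0.
have [i iN|g [us g0 gl gO]] := IH; first by apply: pN; exact: ltnW.
have [ON stepN lenN] := pN N (ltnSn N).
have [g' [us' g'1 g'2]] := unit_speed_extend _ _ (p N.+1) us.
rewrite big_ord_recr /=; set l := \sum_(_ < _) _ in us g0 gl gO us' g'1 g'2 lenN *.
rewrite gl in us' g'2.
have l0 : 0 <= l by case: us.
exists g'; split => //; first by rewrite g'1.
move=> t /andP[t0 tl]; have [tl'|lt] := leP t l.
  by rewrite g'1 //; apply: gO; rewrite t0.
have rN := rho_gt0 _ dO _ ON.
have gt : enorm (g' t - p N) <= t - l.
  rewrite -gl -(g'1 l) //; case: us' => _ lip _; apply: lip => //; exact: ltW.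
have Ogt : Omega (g' t) by apply: (eball_rho_sub _ dO (p N)) => //; rewrite /eball /=; lra.
split => //; have := rho_lipschitz _ dO (p N) (g' t); rewrite enormB => h.
rewrite mulrC ler_pdivrMr; last by lra.
apply: (@le_trans _ _ (rho Omega (p N) / 2 * (2 * C + 1))); first by lra.
by rewrite ler_wpM2r //; lra.
Qed.

End UnitSpeed.

(** * John domains and ends *)

Section JohnToEnds.
Context {R : realType} {n : nat}.
Variables (Omega : set 'rV[R]_n) (x0 : 'rV[R]_n) (Cs : R).
Hypotheses (dOmega : domain Omega) (Omega_x0 : Omega x0) (Cs_ge1 : 1 <= Cs).

Lemma arclength_dist (l t : R) (g : R -> 'rV[R]_n) : arclength_parametrized l g ->
  t \in `[0, l] -> enorm (g t - g 0) <= t.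
Proof.
move=> ag tl; have := tl; rewrite in_itv /= => /andP[+ _].
(* The one-step list [[:: t]] is a partition of [[0, t]] only when [t > 0]. *)
rewrite le_eqVlt => /predU1P[<-|t0]; first by rewrite subrr enorm0.
rewrite -lee_fin -(ag t tl); apply: ereal_sup_ubound.
exists [:: t]; first exact: itv_partition1.
by rewrite /polygon_length /= big_nat1.
Qed.

(** A curve avoiding [B] has connected image in [Omega] minus [B]; a curve in [B] at time [t]
    provides [p = g t], at distance at most [t] from [x]. *)
Lemma john_curve_hits (B : set 'rV[R]_n) (CJ l : R) (g : R -> 'rV[R]_n) x x1 :
  0 <= l -> curve_in Omega l g -> arclength_parametrized l g -> g 0 = x /\ g l = x1 ->
  (forall t : R, t \in `[0, l] -> CJ * t <= rho Omega (g t)) -> 0 < CJ ->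
  connected_component (Omega `\` B) x x1 \/
  exists2 p, B p & CJ * enorm (x - p) <= rho Omega p.
Proof.
move=> l0 [cg gO] ag [g0 gl] gJ CJ0.
have [[t tl Bgt]|nB] := pselect (exists2 t, t \in `[0, l] & B (g t)).
  right; exists (g t) => //; apply: le_trans (gJ t tl).
  by rewrite ler_pM2l // enormB -g0; exact: arclength_dist tl.
left; have Dx : (g @` `[0, l]) x by exists 0 => //=; rewrite in_itv /= lexx.
apply: (connected_component_max Dx).
- by move=> _ [t tl <-]; split; [exact: gO|move=> Bgt; apply: nB; exists t].
- by apply: connected_continuous_connected => //; exact: segment_connected.
- by exists l => //=; rewrite in_itv /= l0 lexx.
Qed.

Lemma john_B_end_le : john_domain Omega -> exists2 CE : R, 0 < CE &
  forall B : set 'rV[R]_n, separating_ball Omega x0 Cs B ->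
    (lebesgue (B_end Omega x0 B) <= CE%:E * lebesgue B)%E.
Proof.
move=> [_ _ [x1 [CJ [Ox1 CJ0 john]]]].
have Cs0 : 0 < Cs by exact: lt_le_trans Cs_ge1.
have r0 := rho_gt0 _ dOmega _ Omega_x0; have r1 := rho_gt0 _ dOmega _ Ox1.
(* For [p] in [B(z, Cs r)], [rho p <= (Cs + 1) r]; so a point whose John curve passes through [p] is
   within [(Cs + 1) / CJ * r + Cs r] of [z]. *)
pose K1 := 1 + (Cs + 1) / CJ + Cs.
have K1_gt0 : 0 < K1 by rewrite !addr_gt0 // divr_gt0 // addr_gt0.
(* The John condition at the endpoint [x1] bounds the length of every John curve by [M]. *)
pose M := rho Omega x1 / CJ.
have M0 : 0 < M by rewrite divr_gt0.
have diam y : Omega y -> enorm (y - x1) <= M.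
  move=> /john [l [g [l0 _ ag [g0 gl] gJ]]].
  have ll : l \in `[0, l] by rewrite in_itv /= l0 lexx.
  have := arclength_dist _ _ _ ag ll; rewrite g0 gl enormB => /le_trans; apply.
  by rewrite /M ler_pdivlMr // mulrC -gl; exact: gJ.
(* If [x0] is within [K1 r] of [z], then [rho x0 <= (1 + K1) r], hence [c0 <= r]. The second term of
   [K] then makes [K r] exceed [2 M], so the ball of radius [K r] about [z] contains [Omega]. *)
pose c0 := Num.min (rho Omega x0) (rho Omega x1) / (1 + K1).
have K1p : 0 < 1 + K1 by rewrite addr_gt0.
have c0_gt0 : 0 < c0 by rewrite divr_gt0 // lt_min r0 r1.
pose K := K1 + (2 * M + 1) / c0.
have K0 : 0 < K by rewrite addr_gt0 // divr_gt0 // addr_gt0 // mulr_gt0.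
exists ((K / Cs) ^+ n); first by rewrite exprn_gt0 // divr_gt0.
move=> _ [x [g [t [Ox [[_ gO] _ _ _] t01 _ ->]]]]; rewrite /sep_ball.
set z := g t; set r := rho Omega z; have Oz : Omega z by exact: gO.
have r_gt0 : 0 < r by exact: rho_gt0.
have near y : (exists2 p, eball z (Cs * r) p & CJ * enorm (y - p) <= rho Omega p) ->
    enorm (y - z) < K1 * r.
  move=> [p Bp yp]; have h1 := rho_lipschitz _ dOmega p z.
  rewrite /eball /= in Bp; have h2 := ler_enorm_tri p y z.
  have : enorm (y - p) <= (Cs + 1) / CJ * r.
    by rewrite mulrAC ler_pdivlMr // mulrC mulrDl mul1r; rewrite -/r in h1; lra.
  by rewrite /K1 !mulrDl mul1r; lra.
have far_small y : Omega y -> Num.min (rho Omega x0) (rho Omega x1) <= (1 + K1) * r ->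
    enorm (y - z) < K * r.
  move=> Oy small; have h1 := ler_enorm_tri x1 y z.
  have h2 := diam _ Oy; have h3 := diam _ Oz; rewrite (enormB z) in h3.
  have c0r : c0 <= r by rewrite /c0 ler_pdivrMr // mulrC.
  have q1 : (2 * M + 1) <= (2 * M + 1) / c0 * r.
    by rewrite mulrAC ler_pdivlMr // ler_pM2l //; lra.
  have q2 : 0 < K1 * r by rewrite mulr_gt0.
  by rewrite /K [(K1 + _) * r]mulrDl; lra.
have small_near w : Omega w -> enorm (w - z) < K1 * r -> rho Omega w <= (1 + K1) * r.
  move=> Ow wz; have := rho_lipschitz _ dOmega w z; rewrite -/r mulrDl mul1r; lra.
have hit y : Omega y -> connected_component (Omega `\` eball z (Cs * r)) y x1 \/
    enorm (y - z) < K1 * r.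
  move=> Oy; have [l [h [l0 ch ah hx1 hJ]]] := john y Oy.
  have [yx1|/near yz] := john_curve_hits (eball z (Cs * r)) _ _ _ _ _ l0 ch ah hx1 hJ CJ0.
    by left.
  by right.
have sub : B_end Omega x0 (eball z (Cs * r)) `<=` eball z (K * r).
  move=> y [C [[w [Ow Bw] <-] nx0] Cy].
  have [Oy By] : (Omega `\` eball z (Cs * r)) y := connected_component_sub Cy.
  have [x0x1|/(small_near _ Omega_x0) x0z] := hit _ Omega_x0; last first.
    by apply: far_small => //; rewrite ge_min x0z.
  have [yx1|yz] := hit _ Oy; last first.
    apply: (lt_le_trans yz).
    by rewrite ler_pM2r // /K lerDl ltW // divr_gt0 // addr_gt0 // mulr_gt0.
  (* Both [y] and [x0] are joined to [x1] outside the ball, so [x0] would lie in the component of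
     [y], which belongs to the end. *)
  exfalso; apply: nx0; apply: (connected_component_trans Cy).
  by apply: (connected_component_trans yx1); exact: connected_component_sym.
apply: le_trans (lebesgue_le _ _ sub) _; apply: (lebesgue_scale _ _ _ z).
  by rewrite divr_gt0.
move=> y; rewrite /eball /= => yz.
rewrite [z + _ - z]addrAC subrr add0r enormZ ger0_norm ?invr_ge0 ?(ltW (divr_gt0 _ _)) //.
rewrite invf_div mulrAC ltr_pdivrMr //.
by rewrite -mulrA ltr_pM2l // mulrC.
Qed.

End JohnToEnds.

(** * From the volume bound on ends to the John condition *)

Section EndsToJohn.
Context {R : realType} {n : nat}.
Variables (Omega : set 'rV[R]_n) (x0 : 'rV[R]_n) (Cs CE : R).
Hypotheses (n_gt0 : (0 < n)%N) (dOmega : domain Omega) (Omega_x0 : Omega x0)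
  (Cs_ge1 : 1 <= Cs) (sepOmega : separation_property Omega x0 Cs) (CE_gt0 : 0 < CE)
  (end_le : forall B : set 'rV[R]_n, separating_ball Omega x0 Cs B ->
      (lebesgue (B_end Omega x0 B) <= CE%:E * lebesgue B)%E).

Let rho_pos y (Oy : Omega y) : 0 < rho Omega y := rho_gt0 _ dOmega _ Oy.
Let Cs_gt0 : 0 < Cs.
Proof. exact: lt_le_trans Cs_ge1. Qed.

Lemma is_box_cube (z : 'rV[R]_n) h : 0 <= h -> is_box (z - const_mx h) (z + const_mx h).
Proof. by move=> h0 i; rewrite !mxE; lra. Qed.

Lemma lebesgue_eball_le (z : 'rV[R]_n) h : 0 <= h -> (lebesgue (eball z h) <= ((2 * h) ^+ n)%:E)%E.
Proof.
move=> h0; apply: le_trans (lebesgue_le _ _ (eball_sub_cube z h)) _.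
by rewrite -(cube_volume z h); apply: lebesgue_box_le => //; exact: is_box_cube.
Qed.

Lemma lebesgue_B_end_le (z : 'rV[R]_n) h : 0 <= h -> separating_ball Omega x0 Cs (eball z h) ->
  (lebesgue (B_end Omega x0 (eball z h)) <= (CE * (2 * h) ^+ n)%:E)%E.
Proof.
move=> h0 /end_le /le_trans; apply; rewrite EFinM lee_pmul2l //.
exact: lebesgue_eball_le.
Qed.

(** The ball about [x0] is itself separating, at time [t = 1] of the curve from any point outside
    it, and its end contains the whole complement. *)
Lemma lebesgue_complement_le :
  (lebesgue (Omega `\` eball x0 (Cs * rho Omega x0)) <=
   (CE * (2 * (Cs * rho Omega x0)) ^+ n)%:E)%E.
Proof.
set B := eball _ _.
have h0 : 0 < Cs * rho Omega x0 by rewrite mulr_gt0 // rho_pos.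
have [[x [Ox Bx]]|/nonemptyPn ->] := pselect (Omega `\` B !=set0); last first.
  apply: (@le_trans _ _ (lebesgue (eball x0 0 : set 'rV[R]_n))); first exact: lebesgue_le.
  apply: le_trans (lebesgue_eball_le x0 0 (lexx 0)) _.
  by rewrite mulr0 expr0n gtn_eqF // lee_fin mulr_ge0 ?exprn_ge0 // ltW // mulr_gt0.
apply: (@le_trans _ _ (lebesgue (B_end Omega x0 B))).
  by apply: lebesgue_le; apply: B_end_center; exact: eball_center.
apply: lebesgue_B_end_le; first exact: ltW.
have [g sg] := sepOmega x Ox; have [_ g0 g1 _] := sg.
exists x, g, 1; split => //; first by rewrite in_itv /= ler01 lexx.
- move=> /(_ x) gB; apply: Bx; apply: gB.
  by exists 0 => //=; rewrite in_itv /= lexx ler01.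
- by rewrite /B /sep_ball g1.
Qed.

(* The half side makes the marker lie within [rho p / 8] of [p] in the Euclidean norm. *)
Definition marker (p : 'rV[R]_n) := cube p (rho Omega p / (8 * n%:R)).

Let n_pos : 0 < n%:R :> R.
Proof. by rewrite ltr0n. Qed.

Lemma marker_radius p : Omega p -> 0 < rho Omega p / (8 * n%:R).
Proof. by move=> Op; rewrite divr_gt0 ?rho_pos // mulr_gt0. Qed.

Lemma marker_enorm p y : Omega p -> marker p y -> enorm (y - p) <= rho Omega p / 8.
Proof.
move=> Op /(cube_enorm _ _ _ (ltW (marker_radius _ Op))) /le_trans; apply.
by rewrite le_eqVlt; apply/orP; left; apply/eqP; field; rewrite gt_eqF.
Qed.

Lemma marker_sub p : Omega p -> marker p `<=` Omega.
Proof.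
move=> Op y py; apply: (eball_rho_sub _ dOmega p) => //.
by have := marker_enorm _ _ Op py; have := rho_pos _ Op; rewrite /eball /=; lra.
Qed.

(** A common point gives [|q - p| <= (rho p + rho q) / 8]; with [rho q <= rho p + |q - p|] this
    yields [|q - p| <= 2/7 rho p], less than [rho p / 2]. *)
Lemma marker_disjoint p q y : Omega p -> Omega q -> rho Omega p / 2 <= enorm (q - p) ->
  marker p y -> marker q y -> False.
Proof.
move=> Op Oq pq /(marker_enorm _ _ Op) yp /(marker_enorm _ _ Oq) yq.
have h1 := rho_lipschitz _ dOmega q p; have h2 := ler_enorm_tri y q p.
by rewrite (enormB q y) in h2; have := rho_pos _ Op; lra.
Qed.

(** The markers are disjoint by the spacing of the [p i], and each has volume [(rho / (4 n))^n];
    [packing] bounds their total. *)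
Lemma marker_packing (p : nat -> 'rV[R]_n) k A z (a h : R) :
  (forall i, (i < k)%N -> Omega (p i)) ->
  (forall i j, (i < j < k)%N -> rho Omega (p i) / 2 <= enorm (p j - p i)) ->
  0 <= h -> (lebesgue A <= a%:E)%E ->
  (forall i, (i < k)%N -> marker (p i) `<=` A `|` cube z h) ->
  \sum_(i < k) rho Omega (p i) ^+ n <= (4 * n%:R) ^+ n * (a + (2 * h) ^+ n).
Proof.
move=> Op sep h0 Aa sub.
pose hh (i : 'I_k) := rho Omega (p i) / (8 * n%:R).
have := @packing R n k (fun i => p i - const_mx (hh i)) (fun i => p i + const_mx (hh i))
  A (z - const_mx h) (z + const_mx h).
move=> /(_ _ _ _ _)/le_trans pack.
have /pack : (lebesgue A + (box_volume (z - const_mx h) (z + const_mx h))%:E <=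
    (a + (2 * h) ^+ n)%:E)%E by rewrite cube_volume EFinD leeD2r.
have n4 : 0 < 4 * n%:R :> R by rewrite mulr_gt0.
have -> : \sum_(j < k) box_volume (p j - const_mx (hh j)) (p j + const_mx (hh j)) =
    (4 * n%:R) ^- n * \sum_(i < k) rho Omega (p i) ^+ n.
  rewrite mulr_sumr; apply: eq_bigr => i _.
  rewrite cube_volume -exprVn -exprMn; congr (_ ^+ _); rewrite /hh.
  by field; rewrite gt_eqF.
rewrite lee_fin ler_pdivrMl ?exprn_gt0 //; apply.
- by move=> i; apply/is_box_cube/ltW/marker_radius/Op.
- exact: is_box_cube.
- apply/trivIsetP => i j _ _ ij; rewrite -subset0 => y [yi yj].
  wlog : i j ij yi yj / (i < j)%N => [H|lij].
    have [|ji] := ltnP i j; first exact: H.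
    by apply: (H j i) => //; [rewrite eq_sym|rewrite ltn_neqAle ji andbT eq_sym].
  by apply: (marker_disjoint (p i) (p j) y) => //; [exact: Op|exact: Op|apply: sep; rewrite lij /=].
- by move=> i; exact: sub.
Qed.

Definition chain_total := (4 * n%:R) ^+ n * ((CE + 1) * (2 * (Cs * rho Omega x0)) ^+ n).

(** The side [4 Cs (1 + Cs) r] dominates both [4 Cs r], the side of the cube about [z] in
    [chain_ratio_le], and [2 Cs rho x0] when [rho x0 <= (1 + Cs) r]. *)
Definition chain_ratio := (4 * n%:R) ^+ n * ((CE + 1) * (4 * Cs * (1 + Cs)) ^+ n).

Lemma chain_ratio_ge1 : 1 <= chain_ratio.
Proof.
have n1 : 1 <= n%:R :> R by rewrite ler1n.
rewrite /chain_ratio mulr_ege1 //; first by rewrite exprn_ege1 //; lra.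
have C1 : 1 <= CE + 1 by rewrite lerDr ltW.
rewrite mulr_ege1 //.
have h1 : 1 <= 4 * Cs by apply: mulr_ege1 => //; rewrite ler1n.
have h2 : 1 <= 1 + Cs by rewrite lerDl ltW.
exact: exprn_ege1 (mulr_ege1 h1 h2).
Qed.

Lemma chain_total_le (p : nat -> 'rV[R]_n) k :
  (forall i, (i < k)%N -> Omega (p i)) ->
  (forall i j, (i < j < k)%N -> rho Omega (p i) / 2 <= enorm (p j - p i)) ->
  \sum_(i < k) rho Omega (p i) ^+ n <= chain_total.
Proof.
move=> Op sep; rewrite /chain_total [(CE + 1) * _]mulrDl mul1r.
apply: (marker_packing _ _ _ x0 _ _ Op sep _ lebesgue_complement_le).
  by rewrite ltW // mulr_gt0 // rho_pos.
move=> i ik y /(marker_sub _ (Op i ik)) Oy.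
have [By|nBy] := pselect (eball x0 (Cs * rho Omega x0) y); last by left.
by right; exact: eball_sub_cube.
Qed.

(** If [rho x0 <= (1 + Cs) r], the global bound [chain_total] suffices. Otherwise [x0] is strictly
    outside the closed ball of radius [Cs r] about [z]; a marker meeting this closed ball lies in a
    cube about [z], and any other lies in the end whenever the curve up to [s k] leaves the open
    ball. *)
Lemma chain_ratio_le x (g : R -> 'rV[R]_n) (s : nat -> R) k : Omega x ->
  separation_curve Omega x0 Cs x g -> (forall i, (i <= k)%N -> 0 <= s i <= s k) ->
  s k <= 1 ->
  (forall i j, (i < j <= k)%N ->
     rho Omega (g (s i)) / 2 <= enorm (g (s j) - g (s i))) ->
  \sum_(i < k) rho Omega (g (s i)) ^+ n <= chain_ratio * rho Omega (g (s k)) ^+ n.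
Proof.
move=> Ox sg s0 sk1 sep; set z := g (s k); set r := rho Omega z.
have [[_ gO] _ _ gsep] := sg.
have s01 i : (i <= k)%N -> s i \in `[0, 1].
  by move=> ik; have /andP[h1 h2] := s0 i ik; rewrite in_itv /= h1 (le_trans h2).
have Op i : (i <= k)%N -> Omega (g (s i)) by move=> /s01; exact: gO.
have Op' i : (i < k)%N -> Omega (g (s i)) by move=> /ltnW; exact: Op.
have sep' i j : (i < j < k)%N -> rho Omega (g (s i)) / 2 <= enorm (g (s j) - g (s i)).
  by move=> /andP[ij /ltnW jk]; apply: sep; rewrite ij.
have Oz : Omega z by exact: Op.
have r0 : 0 < r by exact: rho_pos.
have Csr : 0 < Cs * r by rewrite mulr_gt0.
have C0 : 0 < CE + 1 by rewrite addr_gt0.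
have n4 : 0 < 4 * n%:R :> R by rewrite mulr_gt0.
have qE : 4 * Cs * (1 + Cs) * r = 4 * (Cs * r) + 4 * (Cs * (Cs * r)) by ring.
have q2 : 0 < Cs * (Cs * r) by rewrite mulr_gt0.
have ratioE : chain_ratio * r ^+ n =
    (4 * n%:R) ^+ n * ((CE + 1) * (4 * Cs * (1 + Cs) * r) ^+ n).
  by rewrite /chain_ratio (exprMn n _ r) !mulrA.
have [small|big] := leP (rho Omega x0) ((1 + Cs) * r).
  apply: le_trans (chain_total_le (g \o s) k Op' sep') _.
  rewrite ratioE; apply: ler_wpM2l; first by rewrite exprn_ge0 // ltW.
  have : Cs * rho Omega x0 <= Cs * r + Cs * (Cs * r).
    by rewrite -mulrDr -{1}[r]mul1r -mulrDl ler_pM2l.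
  have : 0 < Cs * rho Omega x0 by rewrite mulr_gt0 // rho_pos.
  move=> q0 q1; rewrite ler_wpM2l ?(ltW C0) // lerXn2r ?nnegrE //; rewrite ?qE; lra.
(* Here [7/8 rho (g (s i)) <= (1 + Cs) r <= 2 Cs r], so two points of the marker are at most
   [4/7 Cs r] apart. *)
have close i y : (i < k)%N -> marker (g (s i)) y -> enorm (y - z) <= Cs * r ->
    marker (g (s i)) `<=` cube z (2 * Cs * r).
  move=> ik iy yz w iw; apply: eball_sub_cube; rewrite /eball /=.
  have h1 := marker_enorm _ _ (Op' _ ik) iy; have h2 := marker_enorm _ _ (Op' _ ik) iw.
  have h3 := rho_lipschitz _ dOmega (g (s i)) z; rewrite -/r in h3.
  have h4 := ler_enorm_tri y (g (s i)) z; rewrite (enormB (g (s i)) y) in h4.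
  have h5 := ler_enorm_tri (g (s i)) w z.
  have h6 : r <= Cs * r by rewrite ler_peMl // ltW.
  lra.
have final A' : (lebesgue A' <= (CE * (2 * (Cs * r)) ^+ n)%:E)%E ->
    (forall i, (i < k)%N -> marker (g (s i)) `<=` A' `|` cube z (2 * Cs * r)) ->
    \sum_(i < k) rho Omega (g (s i)) ^+ n <= chain_ratio * r ^+ n.
  move=> A'le sub.
  apply: le_trans (marker_packing (g \o s) k A' z _ _ Op' sep' _ A'le sub) _.
    by rewrite !mulr_ge0 // ltW.
  rewrite ratioE; apply: ler_wpM2l; first by rewrite exprn_ge0 // ltW.
  rewrite [leRHS]mulrDl mul1r; apply: lerD; [apply: ler_wpM2l; first exact: ltW|];
    rewrite lerXn2r ?nnegrE //; rewrite ?qE; lra.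
have skk : s k \in `[0, 1] by exact: s01.
have sepk := gsep _ skk; rewrite /= /sep_ball -/z -/r in sepk.
have in_image i : (i < k)%N -> (g @` `[0, s k]) (g (s i)).
  by move=> /ltnW ik; exists (s i) => //=; rewrite in_itv /=; exact: s0.
have [inB|ninB] := pselect (g @` `[0, s k] `<=` eball z (Cs * r)).
  (* All markers lie in the cube about [z], so the empty ball of radius 0 serves as [A']. *)
  apply: (final (eball z 0)).
    apply: le_trans (lebesgue_eball_le _ _ (lexx 0)) _.
    by rewrite mulr0 expr0n gtn_eqF // lee_fin mulr_ge0 ?exprn_ge0 // ltW // mulr_gt0.
  move=> i ik y iy; right; apply: (close i (g (s i))) => //.
    by apply/cubeP => j; rewrite subrr normr0; exact/ltW/marker_radius/Op'.
  by apply/ltW/inB/in_image.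
have [//|{}sepk] := sepk.
apply: (final (B_end Omega x0 (eball z (Cs * r)))).
  apply: lebesgue_B_end_le; first exact: ltW.
  by exists x, g, (s k).
move=> i ik; have [[y iy yz]|nclose] :=
    pselect (exists2 y, marker (g (s i)) y & enorm (y - z) <= Cs * r).
  by move=> w iw; right; exact: (close i y).
have far y : marker (g (s i)) y -> Cs * r < enorm (y - z).
  by move=> iy; rewrite ltNge; apply/negP => yz; apply: nclose; exists y.
have ii : marker (g (s i)) (g (s i)).
  by apply/cubeP => j; rewrite subrr normr0; exact/ltW/marker_radius/Op'.
move=> y iy; left.
(* By convexity, the segment from the centre to [y] stays in the marker, hence in [Omega] and off
   the ball; [sub_B_end] carries [y] into the end. *)
have seg := cube_segment _ _ _ iy.
apply: (sub_B_end _ dOmega x0 z (Cs * r) (segment (g (s i)) y) (g (s i))) => //.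
- exact: connected_segment.
- exact: segment_l.
- move=> w /seg iw; split; first exact: (marker_sub _ (Op' _ ik)).
  by apply/negP; rewrite -leNgt ltW // far.
- exact: far.
- have := rho_lipschitz _ dOmega x0 z; rewrite -/r mulrDl mul1r in big *; lra.
- apply: sepk; split; first exact: in_image.
  by apply/negP; rewrite -leNgt ltW // far.
- exact: segment_r.
Qed.

(** [last_exit] for the distance to [g u]; a choice function allows iteration, with an arbitrary
    value for [u] outside [[0, 1]]. *)
Lemma next_point x g : Omega x -> separation_curve Omega x0 Cs x g -> exists nxt : R -> R,
  forall u : R, 0 <= u <= 1 -> [/\ u <= nxt u <= 1,
    enorm (g (nxt u) - g u) <= rho Omega (g u) / 2 &
    nxt u = 1 \/ forall v, nxt u <= v <= 1 -> rho Omega (g u) / 2 <= enorm (g v - g u)].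
Proof.
move=> Ox [[cg gO] _ _ _]; suff H (u : R) : exists v : R, 0 <= u <= 1 -> [/\ u <= v <= 1,
    enorm (g v - g u) <= rho Omega (g u) / 2 &
    v = 1 \/ forall w, v <= w <= 1 -> rho Omega (g u) / 2 <= enorm (g w - g u)].
  by have [nxt nxtP] := choice H; exists nxt.
have [u01|nu] := boolP (0 <= u <= 1); last by exists 0.
have /andP[u0 u1] := u01.
have Ou : Omega (g u) by apply: gO; rewrite in_itv.
have cf : {within `[0, 1], continuous (fun v => enorm (g v - g u))}.
  apply/subspace_continuousP => w w01.
  exact: cvg_comp ((subspace_continuousP _ _).1 cg w w01) (continuous_enorm_dist (g u) (g w)).
have [|||v uv [gv vlast]] := @last_exit R (fun v => enorm (g v - g u)) u 1 (rho Omega (g u) / 2).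
- by [].
- apply: continuous_subspaceW cf.
  by move=> w /=; rewrite !in_itv /= => /andP[uw ->]; rewrite (le_trans u0).
- by rewrite subrr enorm0 divr_ge0 // ltW // rho_pos.
by exists v.
Qed.

Lemma john_of_end_le : john_domain Omega.
Proof.
have [C C0 sumC] := @sum_le_of_power_sum R n chain_ratio n_gt0 chain_ratio_ge1.
have curve x : Omega x -> exists (l : R) (g : R -> 'rV[R]_n),
    [/\ unit_speed l g, g 0 = x, g l = x0 & forall t, 0 <= t <= l ->
      Omega (g t) /\ (2 * C + 1)^-1 * t <= rho Omega (g t)].
  move=> Ox; have [g sg] := sepOmega x Ox.
  have [nxt nxtP] := next_point _ _ Ox sg.
  have [[cg gO] g0 g1 _] := sg.
  pose s i := iter i nxt 0.
  have s01 i : 0 <= s i <= 1.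
    elim: i => [|i /[dup] /andP[h0 h1] /nxtP [/andP[h2 h3] _ _]] /=; first by rewrite lexx ler01.
    by rewrite h3 (le_trans h0).
  have s_mono i j : (i <= j)%N -> s i <= s j.
    apply: (@homo_leq R s <=%O (@lexx _ R) (@le_trans _ R)) => k.
    by have [/andP[]] := nxtP _ (s01 k).
  have Os i : Omega (g (s i)) by apply: gO; rewrite in_itv /= s01.
  (* Since [s] is monotone, [s i.+1 < 1] for [i < k], which leaves the last-exit alternative of
     [next_point]. *)
  have sep k : s k < 1 -> forall i j, (i < j <= k)%N ->
      rho Omega (g (s i)) / 2 <= enorm (g (s j) - g (s i)).
    move=> sk i j /andP[ij jk]; have [_ _ [s1|]] := nxtP _ (s01 i).
      have := s_mono i.+1 k (leq_trans ij jk); rewrite /= s1 => /le_lt_trans /(_ sk).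
      by rewrite ltxx.
    by apply; have /andP[_ ->] := s01 j; rewrite andbT; exact: (s_mono i.+1).
  have ratio k : s k < 1 ->
      \sum_(i < k) rho Omega (g (s i)) ^+ n <= chain_ratio * rho Omega (g (s k)) ^+ n.
    move=> sk; apply: (chain_ratio_le x g s k Ox sg) => //.
    - by move=> i ik; have /andP[-> _] := s01 i; exact: s_mono.
    - exact: ltW.
    - exact: sep.
  have [N sN] : exists N, s N == 1.
    (* An infinite chain would satisfy the ratio bound at every [k] while its power sums stay below
       [chain_total]. *)
    apply: contrapT => noN.
    have sk k : s k < 1.
      by have /andP[_] := s01 k; rewrite le_eqVlt => /orP[sk1|//]; case: noN; exists k.
    apply: (@power_sum_unbounded R n chain_ratio chain_total (fun i => rho Omega (g (s i)))).
    - exact: chain_ratio_ge1.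
    - by move=> j; exact: rho_pos.
    - by move=> k; exact: ratio.
    - move=> k; apply: (chain_total_le (g \o s)) => [i _|i j /andP[ij jk]]; first exact: Os.
      by apply: (sep j) => //; rewrite ij leqnn.
  (* Minimality keeps [s k < 1] for all [k < M], exactly where the ratio bound is used; the polygon
     ends at [g 1 = x0]. *)
  have [{sN}M /eqP sM Mmin] := ex_minnP (ex_intro (fun N => s N == 1) N sN).
  have sk k : (k < M)%N -> s k < 1.
    move=> kM; have /andP[_] := s01 k; rewrite le_eqVlt => /orP[/Mmin|//].
    by rewrite leqNgt kM.
  have step i : enorm (g (s i.+1) - g (s i)) <= rho Omega (g (s i)) / 2.
    by have [] := nxtP _ (s01 i).
  have [|i iM|h [h1 h2 h3 h4]] := @polygon_john R n Omega (g \o s) C M dOmega C0.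
  - exact: Os.
  - split; [exact: Os|exact: step|].
    apply: le_trans (sumC (fun i => rho Omega (g (s i))) M _ _ i iM).
    + apply: ler_sum => j _; apply: le_trans (step j) _.
      by have := rho_pos _ (Os j); lra.
    + by move=> j; rewrite ltW // rho_pos.
    + by move=> k /sk; exact: ratio.
  by exists (\sum_(j < M) enorm ((g \o s) j.+1 - (g \o s) j)), h; split; rewrite ?h2 ?h3 /= ?g0 ?sM.
have CJ0 : 0 < (2 * C + 1)^-1 by rewrite invr_gt0; lra.
split=> //.
(* The first summand bounds the length of each constructed curve, by the John inequality at its
   endpoint [x0]. *)
- pose M := rho Omega x0 / (2 * C + 1)^-1 + enorm x0.
  exists M; split; first exact: num_real.
  move=> M' MM' x Ox; apply: ltW; apply: le_lt_trans MM'; rewrite /M.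
  have [l [g [us g0 gl gJ]]] := curve x Ox; have [l0 lip _] := us.
  apply: le_trans (norm_le_enorm x) _; rewrite -{1}[x](subrK x0).
  apply: le_trans (ler_enormD _ _) _; rewrite lerD2r.
  have [|_ lJ] := gJ l; first by rewrite l0 lexx.
  have := lip 0 l (lexx 0) l0 (lexx l); rewrite subr0 g0 gl enormB => /le_trans; apply.
  by rewrite ler_pdivlMr // mulrC -gl.
- exists x0, (2 * C + 1)^-1; split => // x Ox.
  have [l [g [us g0 gl gJ]]] := curve x Ox; have [l0 _ _] := us.
  exists l, g; split => //.
  + split; first exact: unit_speed_continuous.
    by move=> t; rewrite in_itv => /gJ [].
  + exact: unit_speed_arclength.
  + by move=> t; rewrite in_itv => /gJ [].
Qed.

End EndsToJohn.

Theorem theorem3p4 (R : realType) (n : nat) (n_ge2 : (2 <= n)%N)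
    (Omega : set 'rV[R]_n) (x0 : 'rV[R]_n) (Cs : R)
    (dOmega : domain Omega) (Omega_x0 : Omega x0) (Cs_ge1 : 1 <= Cs)
    (sepOmega : separation_property Omega x0 Cs) :
  john_domain Omega <->
  exists2 CE : R, 0 < CE &
    forall B : set 'rV[R]_n, separating_ball Omega x0 Cs B ->
      (lebesgue (B_end Omega x0 B) <= CE%:E * lebesgue B)%E.
Proof.
split; first exact: john_B_end_le.
move=> [CE CE_gt0 end_le].
exact: (@john_of_end_le R n Omega x0 Cs CE (ltnW n_ge2)).
Qed.
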